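(* For all $n\geq 1$ and $k\geq 0$, the number $b_{n,k}(213,231)$ of permutations $\pi\in\mathfrak{S}_n(213,231)$ with $\mathrm{bdes}(\pi)=k$ is $$b_{n,k}(213,231)=\binom{n}{2k+1}.$$
   Context: $\mathfrak{S}_n$ is the set of permutations $\pi=\pi_1\pi_2\cdots\pi_n$ of $[n]=\{1,\dots,n\}$ in one-line notation. $\mathfrak{S}_n(213,231)$ is the set of $\pi\in\mathfrak{S}_n$ having no length-three subsequence with the same relative order as $213$ or as $231$. An index $k\in[n-1]$ is a big descent of $\pi\in\mathfrak{S}_n$ if $\pi_k>\pi_{k+1}+1$; $\mathrm{bdes}(\pi)$ is the number of big descents of $\pi$. *)

(* Defs.v *)
From mathcomp Require Import all_boot all_fingroup.

Set Implicit Arguments.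
Unset Strict Implicit.
Unset Printing Implicit Defensive.

(* A permutation of [n] is an element of 'S_n: positions and values both range
   over {0, ..., n-1}, i.e. pi_(i+1) is represented by [s i] = pi_(i+1) - 1.
   Relative order and differences of values are unaffected by this shift. *)

(* A pattern is given in one-line notation, e.g. [:: 2; 1; 3]. *)
Definition contains n (s : 'S_n) (p : seq nat) : bool :=
  [exists f : {ffun 'I_(size p) -> 'I_n},
    [forall i : 'I_(size p), forall j : 'I_(size p), (i < j) ==> (f i < f j)] &&
    [forall i : 'I_(size p), forall j : 'I_(size p),
       (s (f i) < s (f j)) == (nth 0 p i < nth 0 p j)]].

Definition avoiders n (ps : seq (seq nat)) : {set 'S_n} :=
  [set s : 'S_n | all (fun p => ~~ contains s p) ps].

Definition big_descents n (s : 'S_n) : {set 'I_n} :=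
  [set i : 'I_n | [exists j : 'I_n, (j == i.+1 :> nat) && (s i > s j + 1)]].

Definition bdes n (s : 'S_n) : nat := #|big_descents s|.

Definition bdes_count n (k : nat) (ps : seq (seq nat)) : nat :=
  #|[set s in avoiders n ps | bdes s == k]|.

(* Main.v *)
Require Import Defs.
From mathcomp Require Import all_boot all_fingroup.
From mathcomp Require Import zify.

Set Implicit Arguments.
Unset Strict Implicit.
Unset Printing Implicit Defensive.

(** A permutation avoids 213 and 231 iff each entry is the minimum or the
    maximum of the suffix it starts ([extremal]).  Prepending a new minimum to
    such a permutation creates no big descent; prepending a new maximum creates
    one iff the old first entry is not the old maximum.  Writing x(n,k), y(n,k)
    for the numbers of permutations of [n] that start with their minimum, resp.
    maximum, and have k big descents, one gets for n >= 2
      x(n+1,k) = x(n,k) + y(n,k)   and   y(n+1,k) = y(n,k) + x(n,k-1),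
    which are Pascal's rules for x(n,k) = C(n-1,2k+1) and y(n,k) = C(n-1,2k).
    The total for [n] is then x(n+1,k) = C(n,2k+1). *)

Lemma contains3P n (s : 'S_n) (a b c : nat) :
  reflect (exists i j l : 'I_n,
             [/\ i < j, j < l,
                 ((s i < s j) == (a < b)) && ((s j < s i) == (b < a)),
                 ((s i < s l) == (a < c)) && ((s l < s i) == (c < a)) &
                 ((s j < s l) == (b < c)) && ((s l < s j) == (c < b))])
          (contains s [:: a; b; c]).
Proof.
apply: (iffP existsP) => [[f /andP[/'forall_forallP incf /'forall_forallP ordf]]|].
  have o (u v : 'I_3) := ordf u v.
  pose x0 : 'I_3 := @Ordinal 3 0 isT; pose x1 : 'I_3 := @Ordinal 3 1 isT.
  pose x2 : 'I_3 := @Ordinal 3 2 isT.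
  exists (f x0), (f x1), (f x2); split.
  - exact: (implyP (incf x0 x1)).
  - exact: (implyP (incf x1 x2)).
  - by apply/andP; split; [exact: (o x0 x1) | exact: (o x1 x0)].
  - by apply/andP; split; [exact: (o x0 x2) | exact: (o x2 x0)].
  - by apply/andP; split; [exact: (o x1 x2) | exact: (o x2 x1)].
move=> [i [j [l [ij jl /andP[ab ba] /andP[ac ca] /andP[bc cb]]]]].
exists [ffun u : 'I_3 => nth i [:: i; j; l] u].
have il := ltn_trans ij jl.
apply/andP; split; apply/'forall_forallP => -[[|[|[|u]]] ltu] // -[[|[|[|v]]] ltv];
  by rewrite ?ffunE ?ltnn.
Qed.

Definition extremal n (s : 'S_n) : bool :=
  [forall i : 'I_n, forall j : 'I_n, forall l : 'I_n,
     [&& i < j, i < l & s j < s i] ==> (s l <= s i)].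

Lemma extremalP n (s : 'S_n) :
  reflect (forall i j l : 'I_n, i < j -> i < l -> s j < s i -> s l <= s i)
          (extremal s).
Proof.
apply: (iffP forallP) => [ext i j l ij il sji | ext i].
  by move/forallP/(_ j)/forallP/(_ l)/implyP: (ext i); apply; apply/and3P.
by apply/'forall_forallP => j l; apply/implyP => /and3P[]; apply: ext.
Qed.

(** A failure of extremality is an entry followed, in some order, by a smaller and a larger one:
    smaller first gives 213, larger first gives 231. *)
Lemma avoiders_213_231 n :
  avoiders n [:: [:: 2; 1; 3]; [:: 2; 3; 1]] = [set s | extremal s].
Proof.
apply/setP => s; rewrite !inE /= andbT -negb_or.
apply/idP/extremalP => [/norP[/contains3P no213 /contains3P no231] i j l ij il sji|ext].
  rewrite leqNgt; apply/negP => sil.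
  have sjl := ltn_trans sji sil.
  case: (ltngtP j l) => [jl|lj|/val_inj jl].
  - by apply: no213; exists i, j, l; split=> //; lia.
  - by apply: no231; exists i, l, j; split=> //; lia.
  - by rewrite jl ltnn in sjl.
apply/norP; split; apply/contains3P => -[i [j [l [ij jl h1 h2 h3]]]].
  by have := ext i j l ij (ltn_trans ij jl); lia.
by have := ext i l j (ltn_trans ij jl) ij; lia.
Qed.

Lemma lift_perm_surj n (s : 'S_n.+1) (i : 'I_n.+1) :
  exists t : 'S_n, s = lift_perm i (s i) t.
Proof.
have neq (u : 'I_n) : s i != s (lift i u) by rewrite (inj_eq perm_inj) neq_lift.
(* The default [u] is never taken: by [neq], the value [s i] does not recur at another position. *)
pose f u := odflt u (unlift (s i) (s (lift i u))).
have fE u : lift (s i) (f u) = s (lift i u).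
  by rewrite /f; case: unliftP (neq u) => [v -> //|->]; rewrite eqxx.
have injf : injective f.
  by move=> u v fuv; apply/(@lift_inj _ i)/(@perm_inj _ s); rewrite -!fE fuv.
exists (perm injf); apply/permP => j.
case: (unliftP i j) => [u ->|->]; last by rewrite lift_perm_id.
by rewrite lift_perm_lift permE fE.
Qed.

Lemma lift_perm_inj n (i j : 'I_n.+1) : injective (@lift_perm n i j).
Proof.
move=> t u tu; apply/permP => v; apply: (@lift_inj _ j).
by rewrite -!(lift_perm_lift i) tu.
Qed.

(** Deleting the entry [j] at position [i] and relabelling inverts [lift_perm i j]. *)
Lemma card_perm_at n (P : pred 'S_n.+1) (i j : 'I_n.+1) :
  #|[set s : 'S_n.+1 | P s & s i == j]| = #|[set t : 'S_n | P (lift_perm i j t)]|.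
Proof.
rewrite -(card_imset _ (@lift_perm_inj n i j)); apply: eq_card => s.
rewrite inE; apply/andP/imsetP => [[Ps /eqP sij]|[t]].
  have [t st] := lift_perm_surj s i.
  by rewrite sij in st; exists t; rewrite // inE -st.
by rewrite inE => Pt ->; rewrite lift_perm_id.
Qed.

(** Otherwise both the least and the greatest value occur after the first position, which violates
    extremality there. *)
Lemma extremal_head n (s : 'S_n.+1) :
  extremal s -> (s ord0 == ord0) || (s ord0 == ord_max).
Proof.
move/extremalP=> ext; apply/norP => -[s0 sn].
have pos c : s ord0 != c -> 0 < (s^-1)%g c.
  rewrite lt0n; apply: contra => /eqP c0.
  by rewrite -(permKV s c) (inj_eq perm_inj); apply/eqP/val_inj.
have := ext ord0 _ _ (pos _ s0) (pos _ sn); rewrite !permKV /=.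
have := ltn_ord (s ord0).
rewrite -!val_eqE /= in s0 sn; lia.
Qed.

(** The order of the old entries is kept, and the new head has either no smaller or no larger entry
    after it. *)
Lemma extremal_lift n (c : 'I_n.+1) (t : 'S_n) :
  (c == ord0) || (c == ord_max) -> extremal (lift_perm ord0 c t) = extremal t.
Proof.
move=> hc; apply/extremalP/extremalP => ext i j l ij il.
  have := ext (lift ord0 i) (lift ord0 j) (lift ord0 l).
  by rewrite !lift_perm_lift /= /bump; lia.
case: (unliftP ord0 j) ij => [j' ->|->] // ij.
case: (unliftP ord0 l) il => [l' ->|->] // il.
case: (unliftP ord0 i) ij il => [i' ->|->] ij il.
  by have := ext i' j' l'; move: ij il; rewrite !lift_perm_lift /= /bump; lia.
rewrite lift_perm_id !lift_perm_lift /=.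
case/orP: hc => /eqP ->; rewrite /= /bump; first lia.
by have := ltn_ord (t l'); lia.
Qed.

Lemma bdesE n (s : 'S_n.+1) :
  bdes s = \sum_(i < n) (s (lift ord0 i) + 1 < s (widen_ord (leqnSn n) i)).
Proof.
rewrite /bdes -sum1_card big_mkcond big_ord_recr /=.
(* The last position has no successor, so it is never a big descent. *)
rewrite [X in _ + X](_ : _ = 0) ?addn0; last first.
  rewrite inE; case: existsP => // -[j /andP[/eqP j_n _]].
  by have := ltn_ord j; rewrite j_n ltnn.
apply: eq_bigr => i _; rewrite inE.
suff -> : [exists j : 'I_n.+1, (j == (widen_ord (leqnSn n) i).+1 :> nat) &&
            (s j + 1 < s (widen_ord (leqnSn n) i))] =
          (s (lift ord0 i) + 1 < s (widen_ord (leqnSn n) i)) by case: ifP.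
apply/existsP/idP => [[j /andP[/eqP ji sj]]|si].
  by rewrite (_ : lift ord0 i = j) //; apply: val_inj.
by exists (lift ord0 i); rewrite si eqxx.
Qed.

(** An extreme [c] shifts all old values by one or none of them, so old differences persist; a
    middle value could widen a gap. *)
Lemma bdes_lift n (c : 'I_n.+2) (t : 'S_n.+1) : (c == ord0) || (c == ord_max) ->
  bdes (lift_perm ord0 c t) = (t ord0 + 1 < c) + bdes t.
Proof.
move=> hc; rewrite !bdesE big_ord_recl.
rewrite (_ : widen_ord _ ord0 = ord0); last exact: val_inj.
rewrite lift_perm_id lift_perm_lift; congr (nat_of_bool _ + _).
  by case/orP: hc => /eqP ->; rewrite /= /bump //; have := ltn_ord (t ord0); lia.
apply: eq_bigr => i _.
rewrite (_ : widen_ord _ (lift ord0 i) = lift ord0 (widen_ord (leqnSn n) i));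
  last exact: val_inj.
rewrite !lift_perm_lift; congr nat_of_bool.
have := ltn_ord (t (lift ord0 i)); have := ltn_ord (t (widen_ord (leqnSn n) i)).
by case/orP: hc => /eqP ->; rewrite /= /bump; lia.
Qed.

(* In permutations of [n.+1]; for [n = 0] the minimum and maximum coincide. *)
Definition num_min n k :=
  #|[set s : 'S_n.+1 | extremal s && (bdes s == k) & s ord0 == ord0]|.
Definition num_max n k :=
  #|[set s : 'S_n.+1 | extremal s && (bdes s == k) & s ord0 == ord_max]|.

Lemma card_extremal n k :
  #|[set s : 'S_n.+2 | extremal s && (bdes s == k)]| = num_min n.+1 k + num_max n.+1 k.
Proof.
rewrite -(cardsID [set s : 'S_n.+2 | s ord0 == ord0]); congr (_ + _); apply: eq_card => s.
  by rewrite !inE.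
rewrite !inE; case: (boolP (extremal s)) => [/extremal_head|]; last by rewrite !andbF.
by case/orP=> /eqP ->; rewrite ?eqxx ?andbT /= ?andbF //.
Qed.

Lemma num_minS n k : num_min n.+1 k = #|[set s : 'S_n.+1 | extremal s && (bdes s == k)]|.
Proof.
rewrite /num_min card_perm_at; apply: eq_card => t.
by rewrite !inE extremal_lift // bdes_lift // ltn0.
Qed.

Lemma num_maxS n k :
  num_max n.+2 k = num_max n.+1 k + (if k is k'.+1 then num_min n.+1 k' else 0).
Proof.
rewrite {1}/num_max card_perm_at -(cardsID [set s : 'S_n.+2 | s ord0 == ord_max]).
congr (_ + _).
  (* The new maximum exceeds the old one by exactly 1, so no big descent arises. *)
  apply: eq_card => t; rewrite !inE extremal_lift ?eqxx ?orbT // bdes_lift ?eqxx ?orbT //.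
  by case: (t ord0 =P _) => [->|]; rewrite ?andbF //= addn1 ltnn.
(* Writing the count with [(bdes s).+1 == k] absorbs the case [k = 0], where the set is empty. *)
have -> : (if k is k'.+1 then num_min n.+1 k' else 0) =
          #|[set s : 'S_n.+2 | extremal s && ((bdes s).+1 == k) & s ord0 == ord0]|.
  case: k => [|k]; last by apply: eq_card => s; rewrite !inE.
  by apply/esym/eqP; rewrite cards_eq0; apply/eqP/setP => s; rewrite !inE andbF.
apply: eq_card => t; rewrite !inE extremal_lift ?eqxx ?orbT // bdes_lift ?eqxx ?orbT //.
case: (boolP (extremal t)) => [/extremal_head|]; last by rewrite !andbF.
by case/orP=> /eqP ->; rewrite ?eqxx ?andbT /= ?andbF.
Qed.

Lemma card_extremal1 k : #|[set s : 'S_1 | extremal s && (bdes s == k)]| = (k == 0).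
Proof.
rewrite -[RHS](_ : #|[set s : 'S_1 | k == 0]| = _).
  apply: eq_card => s; rewrite !inE bdesE big_ord0 eq_sym andbC.
  case: eqP => //= _; apply/extremalP => i j; rewrite !ord1 ltnn //.
case: eqP => _; last by rewrite cards0.
by rewrite cardsT card_Sn.
Qed.

Lemma num_max1 k : num_max 1 k = (k == 0).
Proof.
rewrite /num_max card_perm_at -card_extremal1; apply: eq_card => t.
by rewrite !inE extremal_lift ?eqxx ?orbT // bdes_lift ?eqxx ?orbT //= (ord1 (t ord0)).
Qed.

Lemma num_min_max n k :
  num_min n.+1 k = 'C(n.+1, (2 * k).+1) /\ num_max n.+1 k = 'C(n.+1, 2 * k).
Proof.
elim: n k => [|n IHn] k.
  (* The base case is permutations of two letters: 12 and 21, neither with a big descent. *)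
  rewrite num_minS card_extremal1 num_max1.
  by case: k => [|k] //; rewrite mulnS !bin_small.
split; first by rewrite num_minS card_extremal !(IHn k).1 (IHn k).2 binS.
rewrite num_maxS (IHn k).2; case: k => [|k]; first by rewrite !bin0.
by rewrite (IHn k).1 mulnS binS.
Qed.

Theorem theorem3p1 (n k : nat) (hn : 1 <= n) :
  bdes_count n k [:: [:: 2; 1; 3]; [:: 2; 3; 1]] = 'C(n, 2 * k + 1).
Proof.
case: n hn => // n _; rewrite /bdes_count avoiders_213_231 addn1.
(* Prepending a minimum turns the total into a [num_min] one size up, which also covers one-letter
   permutations. *)
rewrite -(num_min_max n k).1 num_minS.
by apply: eq_card => s; rewrite !inE.
Qed.
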